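(* Let $q\ge1$, $L\ge q+1$, $K\ge q$, and let $H\in\mathbb{C}^{L\times K}$, $U$, $U_0$, $U_1$, $S$, $T$ be the exact ESPRIT data generated by nonzero coefficients and pairwise distinct nodes $\zeta_1,\ldots,\zeta_q\in\mathbb{C}\setminus\{0\}$, as described in the context. Let $\widetilde H=H+E$ with $E\in\mathbb{C}^{L\times K}$, and let $\widetilde S=\widetilde U_0^\dagger\widetilde U_1$ be constructed in the same way from the dominant $q$-dimensional left singular subspace of $\widetilde H$. Put $$\sigma_*:=\sigma_q(H)>0,\qquad s_*:=\sigma_q(U_0)>0 .$$ Then for sufficiently small $\|E\|_2$ the eigenvalues $\widetilde\zeta_1,\ldots,\widetilde\zeta_q$ of $\widetilde S$ can be labeled so that $$\max_j|\widetilde\zeta_j-\zeta_j|\le C_{\mathrm E}\|E\|_2,$$ where $C_{\mathrm E}$ depends on $\sigma_*^{-1}$, $s_*^{-1}$ and $\kappa_2(T)$. If, moreover, the exact nodes lie in a compact subset of an annulus $\{r_1\le|\zeta|\le r_2\}$, $0<r_1\le r_2<\infty$, that avoids the branch cut of the chosen logarithm branch $\operatorname{Log}$, then, for sufficiently small $\|E\|_2$, $$\max_j|\widetilde z_j-z_j|\le C_{\log}C_{\mathrm E}\|E\|_2,\qquad \widetilde z_j=i\operatorname{Log}\widetilde\zeta_j,\quad z_j=i\operatorname{Log}\zeta_j,$$ with a constant $C_{\log}$ depending only on that compact set and the branch.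
   Context: Exact ESPRIT data: $\gamma_m=\sum_{j=1}^q c_j\zeta_j^m$ with all $c_j\ne0$ and pairwise distinct nonzero nodes $\zeta_j=e^{-iz_j}$, for $m=m_0,\ldots,m_0+N-1$, $N=L+K-1$; $\widetilde\gamma_r=\gamma_{m_0+r}$; $H=(\widetilde\gamma_{r+s})_{0\le r\le L-1,\,0\le s\le K-1}$. The matrix $U\in\mathbb{C}^{L\times q}$ has orthonormal columns spanning the dominant $q$-dimensional left singular subspace of $H$ (the span of left singular vectors for the $q$ largest singular values); $U_0$ and $U_1$ are $U$ with its last, respectively first, row deleted; $S=U_0^\dagger U_1$ with $\dagger$ the Moore--Penrose pseudoinverse. In this situation $\operatorname{rank}H=q$, $U_0$ has full column rank, and $S=T^{-1}\operatorname{diag}(\zeta_1,\ldots,\zeta_q)T$ for a nonsingular $T$, which is fixed (namely $U=V_LT$ with $(V_L)_{rj}=\zeta_j^r$, $0\le r\le L-1$). Similarly $\widetilde U\in\mathbb{C}^{L\times q}$ has orthonormal columns spanning the dominant $q$-dimensional left singular subspace of $\widetilde H$, with $\widetilde U_0,\widetilde U_1$ its shifted row blocks. $\sigma_q(\cdot)$ is the $q$th largest singular value, $\|\cdot\|_2$ the spectral norm, and $\kappa_2(T)=\|T\|_2\|T^{-1}\|_2$. *)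

(* Defs.v *)
From HB Require Import structures.
From mathcomp Require Import all_boot all_order all_algebra.
From mathcomp Require Import all_classical all_reals all_analysis.
From mathcomp Require Import complex.

Set Implicit Arguments.
Unset Strict Implicit.
Unset Printing Implicit Defensive.

Import Order.TTheory GRing.Theory Num.Theory.
Import numFieldNormedType.Exports.

Local Open Scope classical_set_scope.
Local Open Scope sesquilinear_scope.
Local Open Scope complex_scope.
Local Open Scope ring_scope.

Section PseudoInverse.
Variable C : numClosedFieldType.

Definition penrose (m n : nat) (A : 'M[C]_(m, n)) (X : 'M[C]_(n, m)) : Prop :=
  [/\ A *m X *m A = A, X *m A *m X = X,
      (A *m X)^t* = A *m X & (X *m A)^t* = X *m A].

Lemma gram_unit (m n : nat) (B : 'M[C]_(m, n)) :
  row_free B -> B *m B^t* \in unitmx.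
Proof.
move=> Bfree; rewrite -row_free_unit -kermx_eq0; apply/rowV0P => v /sub_kermxP.
rewrite mulmxA => vBB0.
have : dotmx (v *m B) (v *m B) = 0.
  by rewrite dotmxE trmx_mul map_mxM mulmxA vBB0 mul0mx mxE.
move=> /eqP; rewrite dnorm_eq0 => /eqP vB0.
by apply: (row_free_inj Bfree); rewrite vB0 mul0mx.
Qed.

Lemma mulmx_tC (m n p : nat) (A : 'M[C]_(m, n)) (B : 'M[C]_(n, p)) :
  (A *m B)^t* = B^t* *m A^t*.
Proof. by rewrite trmx_mul map_mxM. Qed.

Lemma invmx_tC (n : nat) (A : 'M[C]_n) : (invmx A)^t* = invmx (A^t*).
Proof. by rewrite trmx_inv map_invmx. Qed.

Lemma penrose_ex (m n : nat) (A : 'M[C]_(m, n)) : exists X, penrose A X.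
Proof.
have [r [F [G [-> Ffull Gfree]]]] : exists r (F : 'M[C]_(m, r)) (G : 'M[C]_(r, n)),
    [/\ A = F *m G, row_full F & row_free G].
  exists (\rank A), (col_base A), (row_base A).
  by rewrite mulmx_base col_base_full row_base_free.
have Gu : G *m G^t* \in unitmx by exact: gram_unit.
have Fu : F^t* *m F \in unitmx.
  have FD : F^t*^t* = F by exact: trmxCK.
  rewrite -{2}FD; apply: gram_unit.
  by rewrite /row_free mxrank_map mxrank_tr.
pose P := invmx (G *m G^t*); pose Q := invmx (F^t* *m F).
have Ph : P^t* = P by rewrite invmx_tC mulmx_tC trmxCK.
have Qh : Q^t* = Q by rewrite invmx_tC mulmx_tC trmxCK.
have GP : G *m (G^t* *m P) = 1%:M by rewrite mulmxA mulmxV.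
have QF : Q *m F^t* *m F = 1%:M by rewrite -mulmxA mulVmx.
pose X := G^t* *m P *m (Q *m F^t*).
have AX : F *m G *m X = F *m Q *m F^t*.
  by rewrite -mulmxA [G *m X]mulmxA GP mul1mx mulmxA.
have XA : X *m (F *m G) = G^t* *m P *m G.
  by rewrite mulmxA -[X *m F]mulmxA QF mulmx1.
exists X; split.
- by rewrite AX mulmxA -[_ *m F^t* *m F]mulmxA -(mulmxA F) (mulmxA Q) QF mulmx1.
- by rewrite XA -mulmxA (mulmxA G) GP mul1mx.
- by rewrite AX !mulmx_tC trmxCK Qh mulmxA.
- by rewrite XA !mulmx_tC trmxCK Ph mulmxA.
Qed.

End PseudoInverse.

Section Esprit.
Variable R : realType.
Local Notation C := R[i].

(* R-valued, unlike the norm `|z| of R[i], which takes its values in R[i]. *)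
Definition cabs (z : C) : R := Normc.normc z.

Definition vnorm2 (n : nat) (x : 'cV[C]_n) : R :=
  Num.sqrt (\sum_(i < n) cabs (x i 0) ^+ 2).

Definition spectral_norm (m n : nat) (A : 'M[C]_(m, n)) : R :=
  sup [set vnorm2 (A *m x) | x in [set x : 'cV[C]_n | vnorm2 x <= 1]].

Definition cond2 (n : nat) (A : 'M[C]_n) : R :=
  spectral_norm A * spectral_norm (invmx A).

(* The square roots of the eigenvalues of A^* A, with multiplicity, in
   nonincreasing order (A^* A is normal, so spectral_diag lists its
   eigenvalues).  There are n of them, so when m < n the usual list of
   minn m n singular values is padded with zeros. *)
Definition singular_values (m n : nat) (A : 'M[C]_(m, n)) : seq R :=
  sort (fun x y : R => y <= x)
    [seq Num.sqrt (complex.Re (spectral_diag (A^t* *m A) 0 i)) | i : 'I_n].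

(* 1-based: sigma 1 A is the largest singular value. *)
Definition sigma (k m n : nat) (A : 'M[C]_(m, n)) : R :=
  nth 0 (singular_values A) k.-1.

Definition is_svd (m n : nat) (A : 'M[C]_(m, n)) (W : 'M[C]_m) (V : 'M[C]_n)
    : Prop :=
  [/\ W \is unitarymx, V \is unitarymx
    & A = W *m (\matrix_(i < m, j < n)
                  if i == j :> nat then (sigma i.+1 A)%:C else 0) *m V^t*].

(* Row spaces are compared, hence the transpositions (without conjugation):
   the columns of U span the same subspace of C^m as the first q left singular
   vectors. *)
Definition dominant_left_basis (q m n : nat) (A : 'M[C]_(m, n))
    (U : 'M[C]_(m, q)) : Prop :=
  U^t* *m U = 1%:M /\
  exists W V, is_svd A W V /\
    (U^T :=: \sum_(i < m | (i < q)%N) <<(col i W)^T>>)%MS.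

Definition mpinv (m n : nat) (A : 'M[C]_(m, n)) : 'M[C]_(n, m) :=
  xget 0 [set X | penrose A X].

Lemma mpinvP (m n : nat) (A : 'M[C]_(m, n)) : penrose A (mpinv A).
Proof. exact: (xgetPex 0 (penrose_ex A)). Qed.

Section Data.
Variables (q : nat) (m0 : int) (c zeta : 'I_q -> C).

Definition moment (m : int) : C := \sum_(j < q) c j * zeta j ^ m.

Definition hankel (L K : nat) : 'M[C]_(L, K) :=
  \matrix_(r < L, s < K) moment (m0 + (r + s)%N%:Z).

Definition node_vandermonde (L : nat) : 'M[C]_(L, q) :=
  Vandermonde L (\row_j zeta j).

(* L = l.+1, so that a first and a last row exist. *)
Definition exact_esprit (l K : nat) (U : 'M[C]_(l.+1, q)) (T : 'M[C]_q) : Prop :=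
  [/\ forall j, c j != 0,
      forall j, zeta j != 0,
      injective zeta,
      dominant_left_basis (hankel l.+1 K) U
    & U = node_vandermonde l.+1 *m T].

End Data.

Definition del_last (l q : nat) (U : 'M[C]_(l.+1, q)) : 'M[C]_(l, q) :=
  row' ord_max U.

Definition del_first (l q : nat) (U : 'M[C]_(l.+1, q)) : 'M[C]_(l, q) :=
  row' ord0 U.

Definition esprit_mx (l q : nat) (U : 'M[C]_(l.+1, q)) : 'M[C]_q :=
  mpinv (del_last U) *m del_first U.

(* z lists the eigenvalues of A with algebraic multiplicity. *)
Definition eigenvalues_of (q : nat) (A : 'M[C]_q) (z : 'I_q -> C) : Prop :=
  char_poly A = \prod_(j < q) ('X - (z j)%:P).

Definition max_dist (q : nat) (z w : 'I_q -> C) : R :=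
  \big[Num.max/0]_(j < q) cabs (z j - w j).

Definition cexp (z : C) : C :=
  (expR (complex.Re z))%:C * (cos (complex.Im z) +i* sin (complex.Im z)).

(* R[i]^o is R[i] with the topology of its norm.  The cut is an arbitrary
   closed set, e.g. a ray issued from the origin; the last condition forces it
   to contain 0, and the values of Log on the cut are irrelevant. *)
Definition log_branch (cut : set C^o) (Log : C^o -> C^o) : Prop :=
  [/\ closed cut,
      forall z, ~ cut z -> {for z, continuous Log}
    & forall z, ~ cut z -> cexp (Log z) = z].

Definition annulus (r1 r2 : R) : set C^o :=
  [set z | r1 <= cabs z <= r2].

(* The parameter z with zeta = exp (- i z). *)
Definition log_param (Log : C^o -> C^o) (z : C) : C := 'i * Log z.

End Esprit.

(* Main.v *)
Require Import Defs.
From HB Require Import structures.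
From mathcomp Require Import all_boot all_order all_algebra perm.
From mathcomp Require Import all_classical all_reals all_analysis.
From mathcomp Require Import complex.
From mathcomp Require Import ring lra.

Set Implicit Arguments.
Unset Strict Implicit.
Unset Printing Implicit Defensive.

Import Order.TTheory GRing.Theory Num.Theory.
Import numFieldNormedType.Exports.

Local Open Scope classical_set_scope.
Local Open Scope sesquilinear_scope.
Local Open Scope complex_scope.
Local Open Scope ring_scope.

(** Why the theorem holds.  Write [s] for the [q]-th singular value of [H], [t]
    for that of [U0], and [P] for the orthogonal projection onto the perturbed
    dominant subspace.

    The exact basis [U] is of the form [H X] with [|X| <= 1 / s].  Since [H] has
    rank [q], the part of [H + E] outside its dominant subspace has norm
    [sigma q.+1 (H + E) <= |E|], so [|(1 - P) U| <= 2 |E| / s]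
    ([dominant_subspace_perturbation]).  Hence [P U], which is another basis
    of the perturbed subspace, is a small perturbation of [U] itself, and no
    rotation aligning the two orthonormal bases is needed: the spectrum of the
    shift operator does not depend on the basis in which it is computed.  In
    the basis [P U] the perturbed shift operator differs from the exact one [S]
    by at most [4 (1 + 1 / t) |E| / (s t)] ([shift_operator_perturbation]).

    Conjugation by [T] turns [S] into [diag zeta] and multiplies the error by at
    most [cond2 T] ([esprit_mx_similar_diagonal]).  The Bauer-Fike argument puts
    every eigenvalue of the perturbed diagonal matrix within the error of some
    node; for a small error the characteristic polynomial is nearly zero at
    each node, so each node has an eigenvalue nearby, and counting makes the
    labelling a bijection ([perturbed_diagonal_spectrum]).  All constants are
    independent of the dimensions.

    For the logarithms, the exponential expands small distances from the origin
    by at least [1 / 3].  As [exp (Log w) = w] near a node, this makes [Log]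
    Lipschitz there with constant [3 / |zeta|], which is at most [3 / r1] on the
    annulus; only the radius on which this holds varies with the node
    ([log_locally_lipschitz]). *)

(** * Moduli and Euclidean norms *)

Section Norms.
Variable R : realType.
Local Notation C := R[i].
Implicit Types (a b z : C).

Lemma cabsE z : (cabs z)%:C = `|z|.
Proof. by rewrite normc_def; case: z. Qed.

Lemma cabs_ge0 z : 0 <= cabs z.
Proof. by rewrite -lecR cabsE normr_ge0. Qed.

Lemma cabs_eq0 z : (cabs z == 0) = (z == 0).
Proof. by rewrite -(inj_eq (@complexI R)) cabsE normr_eq0. Qed.

Lemma cabs0 : cabs (0 : C) = 0.
Proof. by apply/eqP; rewrite cabs_eq0. Qed.

Lemma cabsM a b : cabs (a * b) = cabs a * cabs b.
Proof. by apply: (@complexI R); rewrite rmorphM /= !cabsE normrM. Qed.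

Lemma cabsD a b : cabs (a + b) <= cabs a + cabs b.
Proof. by rewrite -lecR rmorphD /= !cabsE ler_normD. Qed.

Lemma cabsN a : cabs (- a) = cabs a.
Proof. by apply: (@complexI R); rewrite !cabsE normrN. Qed.

Lemma cabsB a b : cabs (a - b) = cabs (b - a).
Proof. by rewrite -cabsN opprB. Qed.

Lemma cabs_real (x : R) : 0 <= x -> cabs x%:C = x.
Proof. by move=> x0; apply: (@complexI R); rewrite cabsE ger0_norm ?lecR. Qed.

Lemma cabs1 : cabs (1 : C) = 1.
Proof. exact: cabs_real ler01. Qed.

Lemma cabs_prod (I : finType) (F : I -> C) :
  cabs (\prod_i F i) = \prod_i cabs (F i).
Proof.
apply: (@complexI R); rewrite rmorph_prod /= cabsE normr_prod.
by apply: eq_bigr => i _; rewrite cabsE.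
Qed.

Lemma cabs_sum (I : finType) (F : I -> C) :
  cabs (\sum_i F i) <= \sum_i cabs (F i).
Proof.
by rewrite -lecR rmorph_sum /= cabsE (le_trans (ler_norm_sum _ _ _)).
Qed.

Lemma vnorm2_ge0 n (x : 'cV[C]_n) : 0 <= vnorm2 x.
Proof. exact: sqrtr_ge0. Qed.

Lemma vnorm2_sqr n (x : 'cV[C]_n) :
  vnorm2 x ^+ 2 = \sum_(i < n) cabs (x i 0) ^+ 2.
Proof. by rewrite sqr_sqrtr // sumr_ge0 // => i _; rewrite sqr_ge0. Qed.

Lemma vnorm2_inner n (x : 'cV[C]_n) : (vnorm2 x ^+ 2)%:C = (x^t* *m x) 0 0.
Proof.
rewrite vnorm2_sqr rmorph_sum mxE /=; apply: eq_bigr => i _.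
by rewrite !mxE mulrC -normCK -cabsE; exact: rmorphXn.
Qed.

Lemma vnorm2_eq0 n (x : 'cV[C]_n) : (vnorm2 x == 0) = (x == 0).
Proof.
apply/idP/eqP => [/eqP x0|->]; last first.
  rewrite -sqrf_eq0 vnorm2_sqr big1 // => i _.
  by rewrite mxE cabs0 expr0n.
have /eqP : vnorm2 x ^+ 2 = 0 by rewrite x0 expr0n.
rewrite vnorm2_sqr psumr_eq0 => [/allP x00|i _]; last exact: sqr_ge0.
apply/colP => i; rewrite mxE.
have /implyP := x00 i (mem_index_enum i).
by rewrite sqrf_eq0 cabs_eq0 => /(_ isT) /eqP.
Qed.

Lemma vnorm20 n : vnorm2 (0 : 'cV[C]_n) = 0.
Proof. by apply/eqP; rewrite vnorm2_eq0. Qed.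

Lemma vnorm2_gt0 n (x : 'cV[C]_n) : (0 < vnorm2 x) = (x != 0).
Proof. by rewrite lt_def vnorm2_eq0 vnorm2_ge0 andbT. Qed.

Lemma cabs_le_vnorm2 n (x : 'cV[C]_n) i : cabs (x i 0) <= vnorm2 x.
Proof.
rewrite -ler_sqr ?nnegrE ?cabs_ge0 ?vnorm2_ge0 // vnorm2_sqr.
by rewrite (bigD1 i) //= lerDl sumr_ge0 // => j _; rewrite sqr_ge0.
Qed.

Lemma vnorm2Z n a (x : 'cV[C]_n) : vnorm2 (a *: x) = cabs a * vnorm2 x.
Proof.
apply/eqP; rewrite -(@eqrXn2 _ 2) ?mulr_ge0 ?cabs_ge0 ?vnorm2_ge0 //.
rewrite exprMn !vnorm2_sqr mulr_sumr; apply/eqP/eq_bigr => i _.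
by rewrite mxE cabsM exprMn.
Qed.

Lemma vnorm2N n (x : 'cV[C]_n) : vnorm2 (- x) = vnorm2 x.
Proof. by congr Num.sqrt; apply: eq_bigr => i _; rewrite mxE cabsN. Qed.

(** This gives access to the triangle inequality of the Hermitian form. *)
Lemma vnorm2_dotmx n (x : 'cV[C]_n) :
  sqrtC (dotmx x^T x^T) = (vnorm2 x)%:C.
Proof.
rewrite dotmxE; have -> : (x^T *m x^T^t*) 0 0 = (vnorm2 x)%:C ^+ 2.
  transitivity ((vnorm2 x ^+ 2)%:C); last exact: rmorphXn.
  rewrite vnorm2_inner !mxE; apply: eq_bigr => i _.
  by rewrite !mxE mulrC.
by rewrite sqrCK // lecR vnorm2_ge0.
Qed.

Lemma vnorm2D n (x y : 'cV[C]_n) : vnorm2 (x + y) <= vnorm2 x + vnorm2 y.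
Proof.
rewrite -lecR rmorphD /= -!vnorm2_dotmx raddfD /=.
by case: (triangle_lerif (@dotmx _ n) x^T y^T).
Qed.

Lemma vnorm2B n (x y : 'cV[C]_n) : vnorm2 (x - y) <= vnorm2 x + vnorm2 y.
Proof. by rewrite -[vnorm2 y]vnorm2N vnorm2D. Qed.

Lemma vnorm2_isometry m n (A : 'M[C]_(m, n)) (x : 'cV[C]_n) :
  A^t* *m A = 1%:M -> vnorm2 (A *m x) = vnorm2 x.
Proof.
move=> A1; apply/eqP; rewrite -(@eqrXn2 _ 2) ?vnorm2_ge0 //.
apply/eqP/(@complexI R); rewrite !vnorm2_inner mulmx_tC.
by rewrite mulmxA -[x^t* *m A^t* *m A]mulmxA A1 mulmx1.
Qed.

Lemma unitary_tCK n (W : 'M[C]_n) : W \is unitarymx -> W^t* *m W = 1%:M.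
Proof. by move=> Wu; rewrite -invmx_unitary // mulVmx ?unitarymx_unit. Qed.

Lemma unitary_KtC n (W : 'M[C]_n) : W \is unitarymx -> W *m W^t* = 1%:M.
Proof. by move=> Wu; rewrite -invmx_unitary // mulmxV ?unitarymx_unit. Qed.

Lemma vnorm2_proj_sqr n (P : 'M[C]_n) (x : 'cV[C]_n) :
  P^t* = P -> P *m P = P ->
  (vnorm2 (P *m x) ^+ 2)%:C = (x^t* *m P *m x) 0 0.
Proof.
move=> Ph PP; rewrite vnorm2_inner mulmx_tC Ph mulmxA.
by rewrite -[x^t* *m P *m P]mulmxA PP.
Qed.

Lemma cproj_tC n (P : 'M[C]_n) : P^t* = P -> (1%:M - P)^t* = 1%:M - P.
Proof. by move=> Ph; rewrite linearB /= map_mxB Ph trmx1 map_mx1. Qed.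

Lemma cproj_idem n (P : 'M[C]_n) :
  P *m P = P -> (1%:M - P) *m (1%:M - P) = 1%:M - P.
Proof. by move=> PP; rewrite mulmxBl mul1mx mulmxBr mulmx1 PP subrr subr0. Qed.

(** Pythagoras: an orthogonal projection splits [x] into orthogonal pieces. *)
Lemma vnorm2_proj n (P : 'M[C]_n) (x : 'cV[C]_n) :
  P^t* = P -> P *m P = P -> vnorm2 (P *m x) <= vnorm2 x.
Proof.
move=> Ph PP; rewrite -ler_sqr ?nnegrE ?vnorm2_ge0 //.
suff -> : vnorm2 x ^+ 2 = vnorm2 (P *m x) ^+ 2 + vnorm2 ((1%:M - P) *m x) ^+ 2.
  by rewrite lerDl sqr_ge0.
apply: (@complexI R); rewrite rmorphD /= !vnorm2_proj_sqr ?cproj_tC ?cproj_idem //.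
rewrite vnorm2_inner {2}[x](_ : _ = P *m x + (1%:M - P) *m x).
  by rewrite mulmxDr !mulmxA mxE.
by rewrite mulmxBl mul1mx addrC subrK.
Qed.

(** Finiteness of the supremum that defines [spectral_norm]. *)
Lemma vnorm2_mulmx_bounded m n (A : 'M[C]_(m, n)) :
  exists B : R, forall x, vnorm2 x <= 1 -> vnorm2 (A *m x) <= B.
Proof.
exists (\sum_(j < n) vnorm2 (col j A)) => x x1.
have -> : A *m x = \sum_j x j 0 *: col j A.
  apply/colP => i; rewrite mxE summxE; apply: eq_bigr => j _.
  by rewrite !mxE mulrC.
elim/big_rec2: _ => [|j s y _ IH]; first by rewrite vnorm20.
apply: le_trans (vnorm2D _ _) _; apply: lerD => //.
rewrite vnorm2Z ler_piMl ?vnorm2_ge0 //.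
exact: le_trans (cabs_le_vnorm2 _ _) x1.
Qed.

Lemma spectral_norm_set_sup m n (A : 'M[C]_(m, n)) :
  has_sup [set vnorm2 (A *m x) | x in [set x : 'cV[C]_n | vnorm2 x <= 1]].
Proof.
split; first by exists (vnorm2 (A *m 0)), 0 => //=; rewrite vnorm20.
by have [B AB] := vnorm2_mulmx_bounded A; exists B => _ [x /AB ? <-].
Qed.

Lemma spectral_norm_ge0 m n (A : 'M[C]_(m, n)) : 0 <= spectral_norm A.
Proof.
apply: ub_le_sup; first by case: (spectral_norm_set_sup A).
by exists 0; rewrite /= ?mulmx0 vnorm20.
Qed.

Lemma le_spectral_norm m n (A : 'M[C]_(m, n)) x :
  vnorm2 (A *m x) <= spectral_norm A * vnorm2 x.
Proof.
have [->|x0] := eqVneq x 0; first by rewrite mulmx0 !vnorm20 mulr0.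
have nx : 0 < vnorm2 x by rewrite vnorm2_gt0.
rewrite -ler_pdivrMr //.
apply: ub_le_sup; first by case: (spectral_norm_set_sup A).
exists ((vnorm2 x)^-1%:C *: x) => /=.
  by rewrite vnorm2Z cabs_real ?invr_ge0 ?vnorm2_ge0 // mulVf ?lt0r_neq0.
by rewrite -scalemxAr vnorm2Z cabs_real ?invr_ge0 ?vnorm2_ge0 // mulrC.
Qed.

End Norms.

(** * Spectrum of a perturbed diagonal matrix *)

Lemma finite_pos_lower_bound (R : realType) (I : finType) (A : pred I)
    (f : I -> R) :
  (forall i, A i -> 0 < f i) -> exists2 g, 0 < g & forall i, A i -> g <= f i.
Proof.
move=> f0; exists (\big[Num.min/1]_(i | A i) f i).
  by apply/bigmin_gtP; split.
by move=> i Ai; apply: bigmin_le_cond.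
Qed.

Lemma horner_char_poly (F : fieldType) n (A : 'M[F]_n) a :
  (char_poly A).[a] = \det (a%:M - A).
Proof.
rewrite /char_poly -horner_evalE -det_map_mx; congr (\det _).
apply/matrixP => i j; rewrite !mxE /= horner_evalE.
by rewrite hornerD hornerN hornerC hornerMn hornerX.
Qed.

Section Localization.
Variable R : realType.
Local Notation C := R[i].

(** An eigenvector [x] for [lam] satisfies [(lam - D) x = M x], and [lam - D]
    stretches every vector by at least the distance from [lam] to [D]. *)
Lemma bauer_fike n (d : 'I_n -> C) (M : 'M[C]_n) (b : R) lam :
  0 <= b -> (forall x : 'cV_n, vnorm2 (M *m x) <= b * vnorm2 x) ->
  root (char_poly (diag_mx (\row_j d j) + M)) lam ->
  exists j, cabs (lam - d j) <= b.
Proof.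
move=> b0 Mb; rewrite rootE horner_char_poly -det_tr => /det0P [v v0 vA].
set x := v^T; have x0 : x != 0 by rewrite trmx_eq0.
have Ax : (lam%:M - diag_mx (\row_j d j)) *m x = M *m x.
  have : (lam%:M - (diag_mx (\row_j d j) + M)) *m x = 0.
    by rewrite -[LHS]trmxK trmx_mul trmxK vA trmx0.
  by rewrite opprD addrA mulmxBl => /eqP; rewrite subr_eq0 => /eqP.
apply: contrapT => /forallNP far.
have {}far j : b < cabs (lam - d j) by rewrite ltNge; apply/negP/far.
have [k xk] : exists k, x k 0 != 0.
  apply/existsP; apply: contraR x0 => /existsPn x0; apply/eqP/colP => k.
  by have := x0 k; rewrite negbK => /eqP ->; rewrite mxE.
have : (b * vnorm2 x) ^+ 2 < vnorm2 (M *m x) ^+ 2.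
  rewrite -Ax exprMn !vnorm2_sqr mulr_sumr.
  have E i : cabs (((lam%:M - diag_mx (\row_j d j)) *m x) i 0) ^+ 2
     = cabs (lam - d i) ^+ 2 * cabs (x i 0) ^+ 2.
    rewrite -exprMn -cabsM mulmxBl mul_scalar_mx mul_diag_mx.
    by rewrite !mxE -mulrBl.
  rewrite (eq_bigr _ (fun i _ => E i)) (bigD1 k) // [ltRHS](bigD1 k) //=.
  apply: ltr_leD.
    have xk0 : 0 < cabs (x k 0) by rewrite lt_def cabs_ge0 cabs_eq0 xk.
    rewrite ltr_pM2r ?exprn_gt0 //.
    by rewrite ltr_sqr ?nnegrE ?cabs_ge0.
  apply: ler_sum => i _; rewrite ler_wpM2r ?sqr_ge0 //.
  by rewrite ler_sqr ?nnegrE ?cabs_ge0 // ltW.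
rewrite ltr_sqr ?nnegrE ?mulr_ge0 ?vnorm2_ge0 //.
by rewrite ltNge Mb.
Qed.

(** Every term of the Leibniz expansion contains exactly one factor from the
    small row [j]. *)
Lemma cabs_det_le n (A : 'M[C]_n) j (b B : R) :
  0 <= b -> 1 <= B -> (forall k, cabs (A j k) <= b) ->
  (forall i k, cabs (A i k) <= B) -> cabs (\det A) <= n`!%:R * (b * B ^+ n).
Proof.
move=> b0 B1 Ab AB; rewrite /determinant.
apply: le_trans (cabs_sum _) _.
rewrite -(card_Sn n) mulr_natl -sumr_const; apply: ler_sum => s _.
rewrite cabsM; have -> : cabs ((-1) ^+ s : C) = 1.
  by apply: (@complexI R); rewrite cabsE normrX normrN1 expr1n.
rewrite mul1r cabs_prod (bigD1 j) //=; apply: ler_pM; rewrite ?cabs_ge0 //.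
  by apply: prodr_ge0 => i _; rewrite cabs_ge0.
have -> : B ^+ n = \prod_(i < n) B by rewrite prodr_const card_ord.
rewrite [leRHS](bigD1 j) //=.
apply: le_trans (_ : \prod_(i < n | i != j) B <= _).
  by apply: ler_prod => i _; rewrite cabs_ge0 AB.
by rewrite ler_peMl // prodr_ge0 // => i _; rewrite (le_trans ler01).
Qed.

(** The value of a product of linear factors bounds the distance from the
    point to the nearest root. *)
Lemma near_root n (r : 'I_n -> C) z (e : R) :
  0 <= e -> cabs (\prod_k (z - r k)) < e ^+ n -> exists k, cabs (z - r k) < e.
Proof.
move=> e0; rewrite cabs_prod => small; apply: contrapT => /forallNP far.
move: small; apply/negP; rewrite -leNgt.
have -> : e ^+ n = \prod_(i < n) e by rewrite prodr_const card_ord.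
by apply: ler_prod => k _; rewrite e0 leNgt; apply/negP/far.
Qed.

Lemma char_poly_roots n (A : 'M[C]_n) :
  exists r : 'I_n -> C, char_poly A = \prod_k ('X - (r k)%:P).
Proof.
have [s] := closed_field_poly_normal (char_poly A).
rewrite (monicP (char_poly_monic A)) scale1r => As.
have sn : size s = n.
  by apply/eqP; rewrite -eqSS -(size_prod_XsubC s id) -As size_char_poly.
exists (fun k => s`_k); rewrite As (big_nth 0) sn big_mkord.
by [].
Qed.

(** The characteristic polynomial is nearly zero at each node, so each node has
    an eigenvalue closer than half the gap between the nodes; this makes the
    assignment of eigenvalues to nodes injective.  The eigenvalue assigned to
    [d j] then lies within [b] of some node, which can only be [d j]. *)
Lemma perturbed_diagonal_spectrum n (d : 'I_n -> C) : injective d ->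
  exists2 eta : R, 0 < eta & forall (M : 'M[C]_n) (b : R),
    0 <= b -> b < eta -> (forall x : 'cV_n, vnorm2 (M *m x) <= b * vnorm2 x) ->
    exists2 z : 'I_n -> C,
      eigenvalues_of (diag_mx (\row_j d j) + M) z & max_dist z d <= b.
Proof.
move=> d_inj.
have [g g0 gap] : exists2 g : R, 0 < g &
    forall ij : 'I_n * 'I_n, ij.1 != ij.2 -> g <= cabs (d ij.1 - d ij.2).
  apply: finite_pos_lower_bound => -[i j] /= ij.
  by rewrite lt_def cabs_ge0 cabs_eq0 subr_eq0 (inj_eq d_inj) ij.
pose B := 1 + (\sum_i cabs (d i)) *+ 2.
have s0 : 0 <= \sum_i cabs (d i) by apply: sumr_ge0 => i _; rewrite cabs_ge0.
have B1 : 1 <= B by rewrite lerDl mulrn_wge0.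
have B0 : 0 < B by apply: lt_le_trans B1.
have dB i : cabs (d i) <= \sum_i cabs (d i).
  by rewrite (bigD1 i) //= lerDl sumr_ge0 // => k _; rewrite cabs_ge0.
(* Half the gap: the discs of this radius about the nodes are disjoint. *)
pose e := g / 2; have e0 : 0 < e by rewrite divr_gt0.
(* [b * W] bounds the characteristic polynomial at the nodes. *)
pose W : R := n`!%:R * B ^+ n.
have W0 : 0 < W by rewrite mulr_gt0 ?exprn_gt0 // ltr0n fact_gt0.
exists (Num.min e (Num.min 1 (e ^+ n / W))).
  by rewrite !lt_min e0 ltr01 divr_gt0 ?exprn_gt0.
move=> M b b0; rewrite !lt_min => /and3P [be b1 bW] Mb.
set A := _ + M; have [r Ar] := char_poly_roots A.
have Mik i k : cabs (M i k) <= b.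
  have -> : M i k = (M *m delta_mx k 0 : 'cV_n) i 0 by rewrite -colE mxE.
  apply: le_trans (cabs_le_vnorm2 _ _) _; apply: le_trans (Mb _) _.
  rewrite ler_piMr // -[leRHS]sqrtr1 ler_wsqrtr // (bigD1 k) //= big1.
    by rewrite !mxE !eqxx mulr1n cabs1 expr1n addr0.
  by move=> j /negPf jk; rewrite mxE jk cabs0 expr0n.
have near j : exists k, cabs (d j - r k) < e.
  apply: near_root; first exact: ltW.
  have -> : \prod_k (d j - r k) = \det ((d j)%:M - A).
    rewrite -horner_char_poly Ar horner_prod; apply: eq_bigr => k _.
    by rewrite hornerXsubC.
  rewrite ltr_pdivlMr // in bW; apply: le_lt_trans bW.
  rewrite /W mulrCA; apply: (cabs_det_le (j := j)) => // [k|i k].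
    rewrite !mxE opprD addrA -mulrnBl; case: eqP => [->|_].
      by rewrite subrr mul0rn sub0r cabsN.
    by rewrite mulr0n sub0r cabsN.
  rewrite !mxE opprD addrA; apply: le_trans (cabsD _ _) _.
  rewrite cabsN [leLHS]addrC; apply: lerD; first by rewrite (le_trans (Mik i k)) // ltW.
  apply: le_trans (cabsD _ _) _; rewrite cabsN mulr2n; apply: lerD.
    by case: eqP => _; rewrite ?mulr1n ?mulr0n ?cabs0.
  by case: eqP => [->|_]; rewrite ?mulr1n ?mulr0n ?cabs0.
have [f nearf] := choice near.
have close i j (z : C) : cabs (d i - z) < e -> cabs (d j - z) < e -> i = j.
  move=> iz jz; apply/eqP; apply: contraT => /(gap (i, j)) /=.
  rewrite leNgt; have -> : d i - d j = (d i - z) + (z - d j) by rewrite addrA subrK.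
  apply: contraNT => _; rewrite (le_lt_trans (cabsD _ _)) // (cabsB z).
  by rewrite (splitr g) ltrD.
have f_inj : injective f.
  by move=> i j fij; apply: close (nearf i) _; rewrite fij.
exists (fun j => r (f j)).
  rewrite /eigenvalues_of Ar (reindex_inj f_inj) /=.
  by [].
apply: bigmax_le => // j _.
have [i ri] : exists i, cabs (r (f j) - d i) <= b.
  apply: bauer_fike b0 Mb _; rewrite -/A Ar rootE horner_prod (bigD1 (f j)) //=.
  by rewrite hornerXsubC subrr mul0r.
have ij : i = j.
  by apply: (close i j (r (f j))) => //; rewrite cabsB (le_lt_trans ri).
by rewrite -{2}ij.
Qed.

End Localization.

(** * Stability of a branch of the logarithm *)

Section Logarithm.
Variable R : realType.
Local Notation C := R[i].

Lemma cabs_sqr (z : C) :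
  cabs z ^+ 2 = complex.Re z ^+ 2 + complex.Im z ^+ 2.
Proof. by case: z => a b; rewrite /cabs /= sqr_sqrtr // addr_ge0 ?sqr_ge0. Qed.

Lemma cexpD (a b : C) : cexp (a + b) = cexp a * cexp b.
Proof.
case: a b => [a1 a2] [b1 b2]; rewrite /cexp /= expRD cosD sinD.
by apply/eqP; rewrite eq_complex /=; apply/andP; split; apply/eqP; ring.
Qed.

(** By the mean value theorem, since [cos] exceeds [1 / 2] near the origin. *)
Lemma sin_lower_bound :
  exists2 d : R, 0 < d & forall b, `|b| < d -> `|b| / 2 <= `|sin b|.
Proof.
have : \forall x \near (0 : R), 1 / 2 < cos x.
  apply: (@cvgr_gt _ _ _ _ cos (cos 0) (@continuous_cos R 0)).
  by rewrite cos0; lra.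
move=> /nbhs_ballP [d /= d0 cosd]; exists d => // b bd.
wlog b0 : b bd / 0 <= b => [wl|].
  have [/wl -> //|b0] := leP 0 b.
  rewrite -[`|sin b|]normrN -sinN -[`|b|]normrN wl ?normrN //.
  by rewrite oppr_ge0 ltW.
have [c] : exists2 c, c \in `[0, b]%R & sin b - sin 0 = cos c * (b - 0).
  apply: MVT_segment => //.
  by apply: continuous_subspaceT => x; apply: continuous_sin.
rewrite sin0 !subr0 in_itv /= => /andP [c0 cb] ->.
have /= := cosd c; rewrite /ball /= sub0r normrN (ger0_norm c0).
rewrite (ger0_norm b0) in bd *; move=> /(_ (le_lt_trans cb bd)) cosc.
by rewrite ger0_norm ?mulr_ge0 //; nra.
Qed.

(** The squared modulus of [exp (a + ib) - 1] is
    [(exp a - 1)^2 + 2 (exp a) (1 - cos b)], and [2 (1 - cos b)] dominates the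
    square of [sin b]. *)
Lemma cexp_expanding :
  exists2 d : R, 0 < d & forall h : C, cabs h < d ->
    cabs h <= 3 * cabs (cexp h - 1).
Proof.
have [d d0 sind] := sin_lower_bound.
exists (Num.min d (1 / 2)); first by rewrite lt_min d0 /=; lra.
move=> h; rewrite lt_min => /andP [hd h2].
rewrite -ler_sqr ?nnegrE ?mulr_ge0 ?cabs_ge0 // exprMn !cabs_sqr.
have re : `|complex.Re h| <= cabs h.
  rewrite -ler_sqr ?nnegrE ?cabs_ge0 // cabs_sqr real_normK ?num_real //.
  by rewrite lerDl sqr_ge0.
have im : `|complex.Im h| <= cabs h.
  rewrite -ler_sqr ?nnegrE ?cabs_ge0 // cabs_sqr real_normK ?num_real //.
  by rewrite lerDr sqr_ge0.
move: {re im}(le_lt_trans re h2) (sind _ (le_lt_trans im hd)).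
case: h {hd h2} => a b /= a2 sinb.
rewrite /cexp /=.
have := expR_ge1Dx a; have := expR_ge1Dx (- a); rewrite expRN.
have := expR_gt0 a; set x := expR a => x0 xN xP.
have {}xN : (1 - a) * x <= 1.
  by rewrite -ler_pdivlMr // div1r.
have := cos2Dsin2 b.
have {sinb} : (b / 2) ^+ 2 <= sin b ^+ 2.
  rewrite -(real_normK (num_real (sin b))) -(real_normK (num_real (b / 2))).
  rewrite ler_sqr ?nnegrE ?normr_ge0 // normrM.
  by rewrite [X in _ * X]ger0_norm.
have := cos_le1 b; have := cos_geN1 b.
set c := cos b; set s := sin b => c1 c2 bs cs.
move: a2; rewrite ltr_norml => /andP [a1 a2].
rewrite !mul0r !subr0 ?addr0 ?add0r ?oppr0 ?addr0.
have e1 : a ^+ 2 / 4 <= (x - 1) ^+ 2.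
  by have [a0|a0] := leP 0 a; nra.
have e2 : b ^+ 2 / 8 <= 1 - c by nra.
nra.
Qed.

(** With [h = Log w - Log z], the branch property gives [w - z = z (exp h - 1)],
    and [h] is small by continuity of [Log] at [z].  The constant depends on [z]
    only through the lower bound [r] of its modulus. *)
Lemma log_locally_lipschitz (cut : set C^o) (Log : C^o -> C^o) (r : R) (z : C) :
  log_branch cut Log -> ~ cut z -> 0 < r -> r <= cabs z ->
  exists2 rho : R, 0 < rho & forall w, cabs (w - z) < rho ->
    cabs (log_param Log w - log_param Log z) <= 3 / r * cabs (w - z).
Proof.
move=> [cut_closed Log_cont LogK] zcut r0 rz.
have [d d0 expd] := cexp_expanding.
have : \forall w \near (z : C^o), ~ cut w /\ `|Log z - Log w| < d%:C.
  near=> w; split; near: w.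
    by apply: open_nbhs_nbhs; split => //; apply: closed_openC.
  have d0' : 0 < d%:C by rewrite ltcR.
  by have /cvgrPdist_lt /(_ _ d0') := Log_cont z zcut.
move=> /nbhs_ballP [rho /= rho0 near_z].
have rhoE : rho = (complex.Re rho)%:C by rewrite RRe_real // gtr0_real.
exists (complex.Re rho); first by rewrite -ltcR -rhoE.
move=> w wz; have [] : ~ cut w /\ `|Log z - Log w| < d%:C.
  by apply: near_z; rewrite -ball_normE /= -cabsE cabsB rhoE ltcR.
rewrite -cabsE ltcR => wcut small; rewrite cabsB in small.
have wzE : w - z = z * (cexp (Log w - Log z) - 1).
  rewrite -{1}(LogK _ wcut) -{1 2}(LogK _ zcut) mulrBr mulr1 -cexpD.
  by rewrite [Log z + _]addrC subrK.
rewrite /log_param -mulrBr cabsM.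
have -> : cabs ('i : C) = 1.
  by apply: (@complexI R); rewrite cabsE normCi.
rewrite mul1r wzE cabsM; apply: le_trans (expd _ small) _.
have := cabs_ge0 (cexp (Log w - Log z) - 1); set e := cabs (_ - 1) => e0.
rewrite -!mulrA ler_pM2l // mulrA ler_peMl // mulrC.
by rewrite ler_pdivlMr // mul1r.
Unshelve. all: by end_near.
Qed.

End Logarithm.

(** * Singular values *)

Section SingularValues.
Variable R : realType.
Local Notation C := R[i].

(** Rectangular diagonal matrices contain the singular value matrix, the
    identity and the partial identities, and are closed under products. *)
Definition rdiag m n (s : nat -> R) : 'M[C]_(m, n) :=
  \matrix_(i < m, j < n) if i == j :> nat then (s i)%:C else 0.

Lemma eq_rdiag m n (s t : nat -> R) :
  (forall i, (i < m)%N -> (i < n)%N -> s i = t i) -> rdiag m n s = rdiag m n t.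
Proof.
move=> st; apply/matrixP => i j; rewrite !mxE; case: eqP => // ij.
by rewrite st // ij.
Qed.

Lemma rdiag_pid m n r : pid_mx r = rdiag m n (fun i => (i < r)%:R).
Proof.
apply/matrixP => i j; rewrite !mxE; case: eqP => //= _.
by case: (i < r)%N.
Qed.

Lemma rdiag1 n : 1%:M = rdiag n n (fun=> 1).
Proof.
rewrite -pid_mx_1 rdiag_pid; apply: eq_rdiag => i ->.
by [].
Qed.

Lemma rdiagB m n (s t : nat -> R) :
  rdiag m n s - rdiag m n t = rdiag m n (fun i => s i - t i).
Proof.
apply/matrixP => i j; rewrite !mxE; case: eqP => _; last by rewrite subr0.
by rewrite rmorphB.
Qed.

Lemma rdiag_tC m n (s : nat -> R) : (rdiag m n s)^t* = rdiag n m s.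
Proof.
apply/matrixP => i j; rewrite !mxE; have [<-|ij] := eqVneq (i : nat) j.
  exact: conjc_real.
exact: conjC0.
Qed.

Lemma rdiag_mul m n p (s t : nat -> R) :
  rdiag m n s *m rdiag n p t =
  rdiag m p (fun i => if (i < n)%N then s i * t i else 0).
Proof.
apply/matrixP => i j; rewrite !mxE.
have [i_n|n_i] := ltnP i n; last first.
  rewrite big1 ?if_same // => k _; rewrite !mxE.
  by rewrite gtn_eqF ?mul0r // (leq_trans _ n_i).
rewrite (bigD1 (Ordinal i_n)) //= !mxE /= eqxx big1 ?addr0 => [|k ki].
  by case: eqP => _; rewrite ?mulr0 // rmorphM.
rewrite !mxE; case: eqP => [ik|_]; last by rewrite mul0r.
by rewrite -val_eqE /= ik eqxx in ki.
Qed.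

Lemma rdiag_norm m n (s : nat -> R) (y : 'cV[C]_n) :
  vnorm2 (rdiag m n s *m y) ^+ 2 =
  \sum_(j < n) (if (j < m)%N then s j ^+ 2 else 0) * cabs (y j 0) ^+ 2.
Proof.
apply: (@complexI R).
rewrite vnorm2_inner mulmx_tC rdiag_tC -mulmxA [_ *m (_ *m y)]mulmxA rdiag_mul.
rewrite rmorph_sum mxE; apply: eq_bigr => j _ /=.
rewrite !mxE (bigD1 j) //= big1 => [|k kj]; last first.
  by rewrite mxE ifN ?mul0r // eq_sym.
rewrite !mxE eqxx addr0 rmorphM rmorphXn /= cabsE normCK.
by rewrite expr2; ring.
Qed.

Lemma sigma_ge0 k m n (A : 'M[C]_(m, n)) : 0 <= sigma k A.
Proof.
rewrite /sigma; have [lt|ge] := ltnP k.-1 (size (singular_values A)).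
  have := mem_nth 0 lt; rewrite mem_sort => /mapP [i _ ->]; exact: sqrtr_ge0.
by rewrite nth_default.
Qed.

Lemma size_singular_values m n (A : 'M[C]_(m, n)) : size (singular_values A) = n.
Proof. by rewrite size_sort size_map size_enum_ord. Qed.

Lemma sigma_antitone i j m n (A : 'M[C]_(m, n)) :
  (i <= j)%N -> sigma j.+1 A <= sigma i.+1 A.
Proof.
move=> ij; have [jn|nj] := ltnP j n; last first.
  by rewrite [leLHS]nth_default ?size_singular_values // sigma_ge0.
have srt : sorted (fun x y : R => y <= x) (singular_values A).
  by apply: sort_sorted => x y; apply: le_total.
apply: (sorted_leq_nth _ _ 0 srt) => //.
- by move=> x y z yx zy; apply: le_trans zy yx.
- by rewrite inE size_singular_values (leq_ltn_trans ij).
- by rewrite inE size_singular_values.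
Qed.

Lemma sigma_out m n k (A : 'M[C]_(m, n)) : (n <= k)%N -> sigma k.+1 A = 0.
Proof. by move=> nk; rewrite /sigma nth_default ?size_singular_values. Qed.

(** The right singular vectors are the eigenvectors [col i V] of [A^* A], and
    the singular values are the norms [|A (col i V)|]. *)
Lemma singular_vectors m n (A : 'M[C]_(m, n)) : exists V : 'M[C]_n,
  [/\ V \is unitarymx,
      singular_values A = sort (fun x y : R => y <= x)
        [seq vnorm2 (A *m col i V) | i : 'I_n] &
      forall y, vnorm2 (A *m (V *m y)) ^+ 2 =
        \sum_i vnorm2 (A *m col i V) ^+ 2 * cabs (y i 0) ^+ 2].
Proof.
pose G := A^t* *m A; pose d := spectral_diag G.
have Gn : G \is normalmx.
  by apply/normalmxP; rewrite /G mulmx_tC trmxCK.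
have [P Pu GE] : exists2 P, P \is unitarymx & G = P^t* *m diag_mx d *m P.
  exists (spectralmx G); first exact: spectral_unitarymx.
  by rewrite -invmx_unitary ?spectral_unitarymx //; apply/orthomx_spectralP.
have normE y : (vnorm2 (A *m (P^t* *m y)) ^+ 2)%:C =
    \sum_i d 0 i * (cabs (y i 0) ^+ 2)%:C.
  have PK : P *m (P^t* *m y) = y by rewrite mulmxA unitary_KtC // mul1mx.
  rewrite vnorm2_inner mulmx_tC -mulmxA [A^t* *m _]mulmxA -/G GE -!mulmxA PK.
  rewrite mulmxA -mulmx_tC PK mul_diag_mx mxE.
  apply: eq_bigr => i _; rewrite !mxE mulrCA; congr (_ * _).
  by rewrite rmorphXn /= cabsE normCK mulrC.
have dE i : d 0 i = (vnorm2 (A *m col i (P^t*)) ^+ 2)%:C.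
  rewrite colE normE (bigD1 i) //= big1 => [|j ji].
    by rewrite !mxE !eqxx mulr1n cabs1 expr1n mulr1 addr0.
  by rewrite mxE (negPf ji) cabs0 expr0n mulr0.
exists (P^t*); split; first by rewrite trmxC_unitary.
  rewrite /singular_values; congr sort; apply: eq_map => i.
  by rewrite -/G -/d dE /= sqrtr_sqr ger0_norm ?vnorm2_ge0.
move=> y; apply: (@complexI R); rewrite normE rmorph_sum; apply: eq_bigr => i _.
by rewrite dE [RHS]rmorphM.
Qed.

(** In the coordinates of the right singular vectors, [|A x|^2] is a combination
    of the squared singular values with weights summing to [|x|^2], and the
    last entry of the sorted list is the smallest of them. *)
Lemma smallest_singular_value n m (A : 'M[C]_(m, n)) (x : 'cV[C]_n) :
  (0 < n)%N -> sigma n A * vnorm2 x <= vnorm2 (A *m x).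
Proof.
move=> n0; have [V [Vu sE normE]] := singular_vectors A.
have le_sigma i : sigma n A <= vnorm2 (A *m col i V).
  have : vnorm2 (A *m col i V) \in singular_values A.
    by rewrite sE mem_sort; apply/mapP; exists i; rewrite ?mem_enum.
  move=> /(nthP 0) [k]; rewrite size_singular_values => kn <-.
  have k_le : (k <= n.-1)%N by rewrite -ltnS prednK.
  exact: (sigma_antitone A k_le).
rewrite -ler_sqr ?nnegrE ?mulr_ge0 ?vnorm2_ge0 ?sigma_ge0 //.
have <- : V *m (V^t* *m x) = x by rewrite mulmxA unitary_KtC // mul1mx.
rewrite (vnorm2_isometry _ (unitary_tCK Vu)) normE exprMn vnorm2_sqr mulr_sumr.
apply: ler_sum => i _; rewrite ler_wpM2r ?sqr_ge0 //.
by rewrite ler_sqr ?nnegrE ?vnorm2_ge0 ?sigma_ge0.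
Qed.

Lemma smallest_singular_value_gt0 n m (A : 'M[C]_(m, n)) :
  (0 < n)%N -> (forall x : 'cV_n, A *m x = 0 -> x = 0) -> 0 < sigma n A.
Proof.
move=> n0 A_inj; have [V [Vu sE _]] := singular_vectors A.
have : sigma n A \in singular_values A.
  by rewrite mem_nth // size_singular_values prednK.
rewrite sE mem_sort => /mapP [i _ ->].
rewrite vnorm2_gt0; apply/eqP => /A_inj Vi0.
have := vnorm2_isometry (delta_mx i 0 : 'cV_n) (unitary_tCK Vu).
rewrite -colE Vi0 vnorm20 => /esym/eqP; rewrite vnorm2_eq0 => /eqP/colP/(_ i).
by rewrite !mxE !eqxx => /eqP; rewrite oner_eq0.
Qed.

(** A matrix of rank at most [q] annihilates some vector in the span of the
    [q + 1] leading right singular vectors, and [X + E] maps that vector to one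
    at least [sigma q.+1 (X + E)] times longer. *)
Lemma sigma_low_rank_perturbation q m n (X E : 'M[C]_(m, n)) W V :
  (q < m)%N -> (q < n)%N -> (\rank X <= q)%N -> is_svd (X + E) W V ->
  sigma q.+1 (X + E) <= spectral_norm E.
Proof.
move=> qm qn rX [Wu Vu AE].
pose J : 'M[C]_(n, q.+1) := pid_mx q.+1.
have [u u0 uG] : exists2 u : 'rV_q.+1, u != 0 & u *m (X *m V *m J)^T = 0.
  have : kermx (X *m V *m J)^T != 0.
    rewrite kermx_eq0 /row_free mxrank_tr neq_ltn ltnS -mulmxA.
    by rewrite (leq_trans (mxrankM_maxl _ _)).
  by move=> /rowV0Pn [u /sub_kermxP uG u0]; exists u.
have XVz : X *m (V *m (J *m u^T)) = 0.
  by rewrite !mulmxA -[LHS]trmxK trmx_mul trmxK uG trmx0.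
set z := J *m u^T in XVz.
have z0 : vnorm2 z != 0.
  rewrite vnorm2_isometry ?vnorm2_eq0 ?trmx_eq0 //.
  rewrite /J rdiag_pid rdiag_tC rdiag_mul rdiag1; apply: eq_rdiag => i _ iq.
  by rewrite (leq_trans iq) // iq mulr1.
have zout (j : 'I_n) : (q < j)%N -> z j 0 = 0.
  move=> qj; rewrite mxE big1 // => k _; rewrite mxE.
  by rewrite [(j < _)%N]ltnNge qj andbF mul0r.
clearbody z; have := le_spectral_norm E (V *m z).
have -> : E *m (V *m z) = W *m (rdiag m n (fun i => sigma i.+1 (X + E)) *m z).
  rewrite -[LHS]add0r -{1}XVz -mulmxDl {1}AE -!mulmxA [V^t* *m _]mulmxA.
  by rewrite (unitary_tCK Vu) mul1mx.
rewrite (vnorm2_isometry _ (unitary_tCK Wu)) (vnorm2_isometry _ (unitary_tCK Vu)).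
move=> Ez.
rewrite -(ler_pM2r (x := vnorm2 z)) ?lt_def ?z0 ?vnorm2_ge0 //.
apply: le_trans Ez.
rewrite -ler_sqr ?nnegrE ?mulr_ge0 ?vnorm2_ge0 ?sigma_ge0 //.
rewrite rdiag_norm exprMn vnorm2_sqr mulr_sumr; apply: ler_sum => j _.
have [jq|qj] := leqP j q; last by rewrite zout // cabs0 expr0n !mulr0.
rewrite (leq_ltn_trans jq qm) ler_wpM2r ?sqr_ge0 //.
by rewrite ler_sqr ?nnegrE ?sigma_ge0 // sigma_antitone.
Qed.

(** Removing the [q] leading left singular directions leaves a rectangular
    diagonal matrix whose largest entry is [sigma q.+1 A]. *)
Lemma svd_tail q m n (A : 'M[C]_(m, n)) W V (x : 'cV[C]_n) :
  is_svd A W V ->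
  vnorm2 ((1%:M - W *m pid_mx q *m W^t*) *m (A *m x)) <= sigma q.+1 A * vnorm2 x.
Proof.
move=> [Wu Vu AE].
have -> : (1%:M - W *m pid_mx q *m W^t*) *m (A *m x) =
    W *m (rdiag m n (fun i => if (i < q)%N then 0 else sigma i.+1 A)
          *m (V^t* *m x)).
  have -> : 1%:M - W *m pid_mx q *m W^t* = W *m (1%:M - pid_mx q) *m W^t*.
    by rewrite mulmxBr mulmx1 mulmxBl (unitary_KtC Wu).
  rewrite {1}AE -!mulmxA [W^t* *m (W *m _)]mulmxA (unitary_tCK Wu) mul1mx.
  congr (_ *m _); rewrite [LHS]mulmxA; congr (_ *m _).
  rewrite rdiag1 rdiag_pid rdiagB rdiag_mul.
  apply: eq_rdiag => i -> _; case: ltnP => _.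
    by rewrite subrr mul0r.
  by rewrite subr0 mul1r.
rewrite (vnorm2_isometry _ (unitary_tCK Wu)).
rewrite -[vnorm2 x](vnorm2_isometry x (A := V^t*)); last first.
  by rewrite trmxCK unitary_KtC.
rewrite -ler_sqr ?nnegrE ?mulr_ge0 ?vnorm2_ge0 ?sigma_ge0 //.
rewrite rdiag_norm exprMn vnorm2_sqr mulr_sumr; apply: ler_sum => j _.
rewrite ler_wpM2r ?sqr_ge0 //; case: ifP => _; last exact: sqr_ge0.
case: ltnP => [_|qj]; first by rewrite expr0n sqr_ge0.
by rewrite ler_sqr ?nnegrE ?sigma_ge0 // sigma_antitone.
Qed.

(** If [sigma q A] vanished, the singular value decomposition would factor
    through dimension [q - 1]. *)
Lemma svd_sigma_gt0 q m n (A : 'M[C]_(m, n)) W V :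
  (0 < q)%N -> (q <= \rank A)%N -> is_svd A W V -> 0 < sigma q A.
Proof.
move=> q0 qA [_ _ AE]; rewrite lt_def sigma_ge0 andbT.
apply/eqP => sq0; move: qA; rewrite leqNgt => /negP; apply.
have -> : A = W *m rdiag m q.-1 (fun=> 1)
    *m (rdiag q.-1 n (fun i => sigma i.+1 A) *m V^t*).
  rewrite {1}AE [RHS]mulmxA; congr (_ *m _).
  rewrite -[RHS]mulmxA; congr (_ *m _).
  rewrite rdiag_mul; apply: eq_rdiag => i _ _.
  have [_|qi] := ltnP i q.-1; first by rewrite mul1r.
  apply/le_anti/andP; split; last exact: (sigma_ge0 i.+1 A).
  by rewrite -[leRHS]sq0; apply: (sigma_antitone A qi).
rewrite (leq_ltn_trans (mxrankM_maxl _ _)) // (leq_ltn_trans (rank_leq_col _)) //.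
by rewrite prednK.
Qed.

End SingularValues.

(** * Perturbation of the dominant singular subspace *)

Section DominantSubspace.
Variable R : realType.
Local Notation C := R[i].

Lemma pid_mx_isometry m q : (q <= m)%N ->
  (pid_mx q : 'M[C]_(m, q))^t* *m pid_mx q = 1%:M.
Proof.
move=> qm; rewrite !rdiag_pid rdiag_tC rdiag_mul rdiag1; apply: eq_rdiag => i iq _.
by rewrite (leq_trans iq) // iq mulr1.
Qed.

(** The equality of spans becomes an explicit change of basis [Q] from the leading
    left singular vectors to the columns of [U]; it is unitary as both families
    are orthonormal. *)
Lemma dominant_factor q m n (A : 'M[C]_(m, n)) (U : 'M[C]_(m, q)) :
  (q <= m)%N -> dominant_left_basis A U ->
  exists (W : 'M[C]_m) (V : 'M[C]_n) (Q : 'M[C]_q), [/\ is_svd A W V, U = W *m pid_mx q *m Q & Q^t* *m Q = 1%:M].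
Proof.
move=> qm [UU [W [V [svdA UW]]]]; exists W, V.
have [Wu _ _] := svdA.
have /submxP [D UD] : (U^T <= (W *m (pid_mx q : 'M[C]_(m, q)))^T)%MS.
  rewrite UW; apply/sumsmx_subP => i iq; rewrite genmxE.
  have -> : col i W = col (Ordinal iq) (W *m pid_mx q).
    rewrite !colE -mulmxA; congr (_ *m _); apply/colP => k.
    rewrite -colE !mxE eqxx andbT /=; case: eqP => [->|/eqP ki].
      by rewrite eqxx iq.
    by rewrite -val_eqE /= in ki; rewrite (negPf ki).
  by rewrite tr_col row_sub.
have UE : U = W *m pid_mx q *m D^T.
  by rewrite -[LHS]trmxK UD trmx_mul trmxK.
exists D^T; split => //.
move: UU; rewrite UE !mulmx_tC -!mulmxA [W^t* *m (W *m _)]mulmxA.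
rewrite (unitary_tCK Wu) mul1mx [(pid_mx q)^t* *m (_ *m _)]mulmxA.
by rewrite pid_mx_isometry // mul1mx.
Qed.

Lemma orthonormal_projector m q (U : 'M[C]_(m, q)) :
  U^t* *m U = 1%:M ->
  (U *m U^t*)^t* = U *m U^t* /\ U *m U^t* *m (U *m U^t*) = U *m U^t*.
Proof.
move=> UU; split; first by rewrite mulmx_tC trmxCK.
by rewrite -mulmxA [U^t* *m _]mulmxA UU mul1mx.
Qed.

(** Write [U = H X] with [|X x| <= |x| / sigma q H] and let [P] be the
    projection onto the perturbed subspace.  Then
    [(1 - P) U = (1 - P) (H + E) X - (1 - P) E X], and the norm of
    [(1 - P) (H + E)] is the [(q + 1)]-st singular value of [H + E]. *)
Lemma dominant_subspace_perturbation q m n (H E : 'M[C]_(m, n))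
    (U Ut : 'M[C]_(m, q)) (x : 'cV[C]_q) :
  (0 < q)%N -> (q < m)%N -> (q <= n)%N -> \rank H = q ->
  dominant_left_basis H U -> dominant_left_basis (H + E) Ut ->
  vnorm2 ((1%:M - Ut *m Ut^t*) *m (U *m x)) <=
    2 * (sigma q H)^-1 * spectral_norm E * vnorm2 x.
Proof.
move=> q0 qm qn rH /(dominant_factor (ltnW qm)) [W [V [Q [svdH UE QQ]]]] domt.
have [Utt _] := domt; have [Ph PP] := orthonormal_projector Utt.
have [Wt [Vt [Qt [svdt UtE QQt]]]] := dominant_factor (ltnW qm) domt.
have s0 : 0 < sigma q H by apply: svd_sigma_gt0 svdH; rewrite ?rH.
have [Wu Vu HE] := svdH.
(* The projection depends on the subspace only: [Qt] cancels. *)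
have PE : Ut *m Ut^t* = Wt *m pid_mx q *m Wt^t*.
  rewrite UtE !mulmx_tC -!mulmxA [Qt *m (Qt^t* *m _)]mulmxA (mulmx1C QQt) mul1mx.
  congr (_ *m _); rewrite !mulmxA; congr (_ *m _).
  rewrite !rdiag_pid rdiag_tC rdiag_mul; apply: eq_rdiag => i _ _.
  by case: (i < q)%N; rewrite ?mulr1.
pose D := rdiag q q (fun i => (sigma i.+1 H)^-1).
pose y := V *m (pid_mx q *m (D *m (Q *m x))).
have UxE : U *m x = H *m y.
  rewrite UE {1}HE /y -!mulmxA [V^t* *m (V *m _)]mulmxA (unitary_tCK Vu) mul1mx.
  congr (_ *m _); rewrite ![in RHS]mulmxA [LHS]mulmxA.
  congr (_ *m _ *m _).
  rewrite !rdiag_pid -/(rdiag m n (fun i => sigma i.+1 H)) !rdiag_mul.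
  apply: eq_rdiag => i _ iq; rewrite iq (leq_trans iq qn) mulr1 divff //.
  by rewrite lt0r_neq0 // (lt_le_trans s0) // -(prednK q0) sigma_antitone // -ltnS prednK.
have ny : vnorm2 y <= (sigma q H)^-1 * vnorm2 x.
  rewrite (vnorm2_isometry _ (unitary_tCK Vu)) (vnorm2_isometry _ (pid_mx_isometry qn)).
  rewrite -(vnorm2_isometry x QQ).
  rewrite -ler_sqr ?nnegrE ?mulr_ge0 ?vnorm2_ge0 ?invr_ge0 ?(ltW s0) //.
  rewrite rdiag_norm exprMn vnorm2_sqr mulr_sumr; apply: ler_sum => j _.
  rewrite ltn_ord ler_wpM2r ?sqr_ge0 //.
  have sj : sigma q H <= sigma j.+1 H.
    have jq : (j <= q.-1)%N by rewrite -ltnS prednK.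
    exact: (sigma_antitone H jq).
  by rewrite ler_sqr ?nnegrE ?invr_ge0 ?sigma_ge0 // lef_pV2 ?posrE // (lt_le_trans s0).
have tail : vnorm2 ((1%:M - Ut *m Ut^t*) *m ((H + E) *m y)) <=
    spectral_norm E * vnorm2 y.
  rewrite PE; apply: le_trans (svd_tail _ _ svdt) _.
  rewrite ler_wpM2r ?vnorm2_ge0 //.
  (* For [n = q] there is no singular value of index [q + 1]. *)
  have [qn'|nq] := ltnP q n.
    by apply: sigma_low_rank_perturbation svdt; rewrite ?rH.
  by rewrite sigma_out // spectral_norm_ge0.
have -> : (1%:M - Ut *m Ut^t*) *m (U *m x) =
    (1%:M - Ut *m Ut^t*) *m ((H + E) *m y) - (1%:M - Ut *m Ut^t*) *m (E *m y).
  by rewrite -mulmxBr -mulmxBl addrK UxE.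
have cP : vnorm2 ((1%:M - Ut *m Ut^t*) *m (E *m y)) <= spectral_norm E * vnorm2 y.
  apply: le_trans (le_spectral_norm _ _).
  by apply: vnorm2_proj; [apply: cproj_tC|apply: cproj_idem].
apply: le_trans (vnorm2B _ _) _; apply: le_trans (lerD tail cP) _.
rewrite -[leLHS]mulr2n -[leLHS]mulr_natl -!mulrA ler_wpM2l // [leRHS]mulrCA.
by rewrite ler_wpM2l ?spectral_norm_ge0.
Qed.

End DominantSubspace.

(** * Shift invariance of the signal space *)

Section Hankel.
Variable R : realType.
Local Notation C := R[i].
Variables (q : nat) (m0 : int) (c zeta : 'I_q -> C).
Hypothesis zeta_inj : injective zeta.

(** The first [q] rows form a square Vandermonde matrix, invertible because the
    nodes are distinct. *)
Lemma node_vandermonde_inj L (x : 'cV[C]_q) :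
  (q <= L)%N -> node_vandermonde zeta L *m x = 0 -> x = 0.
Proof.
move=> qL Vx; pose Vq := Vandermonde q (\row_j zeta j).
have Vqu : Vq \in unitmx.
  rewrite unitmxE det_Vandermonde unitfE; apply/prodf_neq0 => i _.
  apply/prodf_neq0 => j ij; rewrite !mxE subr_eq0 (inj_eq zeta_inj).
  by rewrite -val_eqE /= gtn_eqF.
have : Vq *m x = 0.
  apply/colP => i; have /colP /(_ (widen_ord qL i)) := Vx.
  rewrite !mxE => Vxi; rewrite -[RHS]Vxi.
  by apply: eq_bigr => j _; rewrite !mxE.
by move=> /(congr1 (mulmx (invmx Vq))); rewrite mulmxA mulVmx // mul1mx mulmx0.
Qed.

Lemma node_vandermonde_tr_free L : (q <= L)%N -> row_free (node_vandermonde zeta L)^T.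
Proof.
move=> qL; apply: inj_row_free => v vV; rewrite -[v]trmxK.
by rewrite (node_vandermonde_inj (x := v^T) qL) ?trmx0 // -[LHS]trmxK trmx_mul trmxK vV trmx0.
Qed.

Lemma hankel_factor L K : (forall j, zeta j != 0) ->
  hankel m0 c zeta L K = node_vandermonde zeta L
    *m (diag_mx (\row_j (c j * zeta j ^ m0)) *m (node_vandermonde zeta K)^T).
Proof.
move=> z0; apply/matrixP => r s; rewrite mul_diag_mx !mxE; apply: eq_bigr => j _.
rewrite !mxE expfzDr // -exprnP exprD; ring.
Qed.

Lemma rank_hankel L K : (forall j, c j != 0) -> (forall j, zeta j != 0) ->
  (q <= L)%N -> (q <= K)%N -> \rank (hankel m0 c zeta L K) = q.
Proof.
move=> c0 z0 qL qK; rewrite hankel_factor // -mxrank_tr trmx_mul.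
rewrite mxrankMfree ?node_vandermonde_tr_free // mxrank_tr.
rewrite mxrankMfree ?node_vandermonde_tr_free // mxrank_unit //.
rewrite unitmxE det_diag unitfE; apply/prodf_neq0 => j _.
by rewrite mxE mulf_neq0 // expfz_neq0.
Qed.

Lemma del_last_vandermonde l (T : 'M[C]_q) :
  del_last (node_vandermonde zeta l.+1 *m T) = node_vandermonde zeta l *m T.
Proof.
apply/matrixP => i j; rewrite !mxE; apply: eq_bigr => k _; rewrite !mxE.
by rewrite lift_max.
Qed.

Lemma del_first_vandermonde l (T : 'M[C]_q) :
  del_first (node_vandermonde zeta l.+1 *m T) =
  node_vandermonde zeta l *m (diag_mx (\row_j zeta j) *m T).
Proof.
apply/matrixP => i j; rewrite mul_diag_mx !mxE; apply: eq_bigr => k _.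
by rewrite !mxE lift0 exprSr mulrA.
Qed.

End Hankel.

Section RowDeletion.
Variable R : realType.
Local Notation C := R[i].

Lemma row'_mul m n p i (A : 'M[C]_(m.+1, n)) (B : 'M[C]_(n, p)) :
  row' i (A *m B) = (row' i A : 'M[C]_(m, n)) *m B.
Proof.
apply/matrixP => j k; rewrite !mxE; apply: eq_bigr => a _.
by rewrite mxE.
Qed.

Lemma vnorm2_row' n i (x : 'cV[C]_n.+1) : vnorm2 (row' i x) <= vnorm2 x.
Proof.
rewrite -ler_sqr ?nnegrE ?vnorm2_ge0 // !vnorm2_sqr [leRHS](bigD1_ord i) //=.
rewrite ler_wpDl ?sqr_ge0 //.
by under eq_bigr => j _ do rewrite mxE.
Qed.

End RowDeletion.

(** * The perturbed shift operator *)

Section ShiftOperator.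
Variable R : realType.
Local Notation C := R[i].

Lemma mpinv_left_inverse m n (A : 'M[C]_(m, n)) :
  (forall x : 'cV_n, A *m x = 0 -> x = 0) -> mpinv A *m A = 1%:M.
Proof.
move=> A_inj; have [AXA _ _ _] := mpinvP A.
have colE0 j : col j (mpinv A *m A - 1%:M) = 0.
  by apply: A_inj; rewrite colE mulmxA mulmxBr mulmx1 mulmxA AXA subrr mul0mx.
apply/eqP; rewrite -subr_eq0; apply/eqP/matrixP => i j.
have /colP/(_ i) := colE0 j; rewrite [LHS]mxE => ->.
by rewrite !mxE.
Qed.

(** [A *m mpinv A] is the orthogonal projection onto the range of [A]. *)
Lemma vnorm2_mpinv m n (A : 'M[C]_(m, n)) (y : 'cV[C]_m) :
  vnorm2 (A *m (mpinv A *m y)) <= vnorm2 y.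
Proof.
have [AXA _ AXh _] := mpinvP A.
by rewrite mulmxA; apply: vnorm2_proj => //; rewrite mulmxA AXA.
Qed.

Lemma unitmx_inj n (G : 'M[C]_n) :
  (forall x : 'cV_n, G *m x = 0 -> x = 0) -> G \in unitmx.
Proof.
move=> G_inj; rewrite -unitmx_tr -row_free_unit; apply: inj_row_free => v vG.
rewrite -[v]trmxK (G_inj v^T) ?trmx0 //.
by rewrite -[LHS]trmxK trmx_mul trmxK vG trmx0.
Qed.

(** The shift operator of a perturbed signal space, expressed in the basis
    [U + F] of that space instead of the orthonormal one, is [Y (U1 + F1)] with
    [Y] the left inverse of [U0 + F0] of norm at most [2 / s]; hence it differs
    from [S] by [Y ((U1 + F1) - (U0 + F0) S) = Y (F1 - F0 S)]. *)
Lemma shift_operator_perturbation l q (U0 U1 F0 F1 Ut0 Ut1 : 'M[C]_(l, q))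
    (S G : 'M[C]_q) (s f : R) :
  0 < s -> 0 <= f -> f <= s / 2 ->
  U1 = U0 *m S ->
  (forall x : 'cV_q, s * vnorm2 x <= vnorm2 (U0 *m x)) ->
  (forall x : 'cV_q, vnorm2 (U1 *m x) <= vnorm2 x) ->
  (forall x : 'cV_q, vnorm2 (F0 *m x) <= f * vnorm2 x) ->
  (forall x : 'cV_q, vnorm2 (F1 *m x) <= f * vnorm2 x) ->
  Ut0 *m G = U0 + F0 -> Ut1 *m G = U1 + F1 ->
  G \in unitmx /\
  forall x : 'cV_q,
    vnorm2 ((invmx G *m (mpinv Ut0 *m Ut1) *m G - S) *m x) <=
    2 * s^-1 * (1 + s^-1) * f * vnorm2 x.
Proof.
move=> s0 f0 fs U1E U0s U11 F0f F1f G0 G1.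
(* As [f <= s / 2], at least half of the lower bound for [U0] survives. *)
have lower (x : 'cV_q) : s / 2 * vnorm2 x <= vnorm2 (Ut0 *m (G *m x)).
  rewrite mulmxA G0 mulmxDl.
  have := vnorm2B (U0 *m x + F0 *m x) (F0 *m x); rewrite addrK.
  have := U0s x; have := F0f x; have := ler_wpM2r (vnorm2_ge0 x) fs.
  move: (vnorm2 _) (vnorm2 _) (vnorm2 _) (vnorm2 _) => a b d e.
  lra.
have inj_of (x : 'cV_q) : Ut0 *m (G *m x) = 0 -> x = 0.
  move=> Gx; have := lower x; rewrite Gx vnorm20 pmulr_rle0 ?divr_gt0 //.
  by move=> nx; apply/eqP; rewrite -vnorm2_eq0 eq_le nx vnorm2_ge0.
have Gu : G \in unitmx.
  by apply: unitmx_inj => x Gx; apply: inj_of; rewrite Gx mulmx0.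
split => // x.
have XU : mpinv Ut0 *m Ut0 = 1%:M.
  apply: mpinv_left_inverse => z; rewrite -[z](mulKVmx Gu) => /inj_of ->.
  by rewrite mulmx0.
have SE : (invmx G *m (mpinv Ut0 *m Ut1) *m G - S) *m x =
    invmx G *m (mpinv Ut0 *m ((F1 - F0 *m S) *m x)).
  rewrite !mulmxA; congr (_ *m _).
  have -> : F1 - F0 *m S = Ut1 *m G - Ut0 *m G *m S.
    by rewrite G0 G1 U1E mulmxDl opprD addrACA subrr add0r.
  rewrite mulmxBr !mulmxA -[invmx G *m _ *m Ut0]mulmxA XU mulmx1.
  by rewrite mulVmx // mul1mx.
have Sx : vnorm2 (S *m x) <= s^-1 * vnorm2 x.
  rewrite ler_pdivlMl //; apply: le_trans (U0s _) _.
  by rewrite mulmxA -U1E.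
have Fx : vnorm2 ((F1 - F0 *m S) *m x) <= (1 + s^-1) * f * vnorm2 x.
  rewrite mulmxBl -mulmxA; apply: le_trans (vnorm2B _ _) _.
  apply: le_trans (lerD (F1f x) (F0f _)) _.
  rewrite mulrDl mul1r mulrDl lerD2l -[leRHS]mulrA [leRHS]mulrCA.
  exact: ler_wpM2l.
have := lower ((invmx G *m (mpinv Ut0 *m Ut1) *m G - S) *m x).
rewrite {2}SE mulKVmx // => low.
have {low}low := le_trans low (le_trans (vnorm2_mpinv _ _) Fx).
rewrite -!mulrA [2 * _](_ : _ = (s / 2)^-1 * ((1 + s^-1) * f * vnorm2 x)).
  by rewrite ler_pdivlMl // divr_gt0.
by rewrite invf_div !mulrA.
Qed.

Lemma char_poly_conj n (Z A : 'M[C]_n) :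
  Z \in unitmx -> char_poly (Z *m A *m invmx Z) = char_poly A.
Proof.
move=> Zu; rewrite /char_poly /char_poly_mx.
pose Zp := map_mx (@polyC C) Z.
have Zpu : Zp \in unitmx by rewrite map_unitmx.
have -> : 'X%:M - map_mx (@polyC C) (Z *m A *m invmx Z) =
    Zp *m ('X%:M - map_mx (@polyC C) A) *m map_mx (@polyC C) (invmx Z).
  rewrite mulmxBr mulmxBl !map_mxM; congr (_ - _).
  by rewrite scalar_mxC -mulmxA -map_mxM mulmxV // map_mx1 mulmx1.
by rewrite !det_mulmx mulrAC -det_mulmx -map_mxM mulmxV // map_mx1 det1 mul1r.
Qed.

End ShiftOperator.

(** * The ESPRIT eigenvalues *)

Section Esprit.
Variable R : realType.
Local Notation C := R[i].

(** The arguments stand for [1 / sigma q H], [1 / sigma q U0] and [cond2 T].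
    The factor 4 is 2 from the subspace bound times 2 from halving the
    smallest singular value of [U0]. *)
Definition esprit_const (a b k : R) : R := 4 * a * b * (1 + b) * k.

Lemma le_max_dist n (z w : 'I_n -> C) j : cabs (z j - w j) <= max_dist z w.
Proof. exact: (le_bigmax _ (fun j => cabs (z j - w j)) j). Qed.

Section Exact.
Variables (q l K : nat) (m0 : int) (c zeta : 'I_q -> C).
Variables (U : 'M[C]_(l.+1, q)) (T : 'M[C]_q).
Hypotheses (q0 : (1 <= q)%N) (ql : (q + 1 <= l.+1)%N) (qK : (q <= K)%N).
Hypothesis exactU : exact_esprit m0 c zeta K U T.

Let H := hankel m0 c zeta l.+1 K.
Let D := diag_mx (\row_j zeta j).

Lemma rank_exact_hankel : \rank H = q.
Proof.
have [c0 z0 z_inj _ _] := exactU.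
by apply: rank_hankel => //; rewrite ltnW // -addn1.
Qed.

Lemma exact_sigma_gt0 : 0 < sigma q H.
Proof.
have [_ _ _ [_ [W [V [svdH _]]]] _] := exactU.
by apply: svd_sigma_gt0 svdH; rewrite ?rank_exact_hankel.
Qed.

Lemma exact_basis_unit : T \in unitmx.
Proof.
have [_ _ _ [UU _] UT] := exactU.
by move: UU; rewrite {2}UT mulmxA => /mulmx1_unit [].
Qed.

Lemma exact_del_last_gt0 : 0 < sigma q (del_last U).
Proof.
have [_ _ z_inj _ UT] := exactU.
apply: smallest_singular_value_gt0 => // x.
rewrite UT del_last_vandermonde -mulmxA.
move=> /(node_vandermonde_inj z_inj) Tx.
rewrite -[x](mulKmx exact_basis_unit) Tx ?mulmx0 //.
by rewrite -ltnS -addn1.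
Qed.

(** Deleting the first row of a Vandermonde matrix multiplies every column by its
    node. *)
Lemma exact_shift_invariance :
  del_first U = del_last U *m (invmx T *m D *m T).
Proof.
have [_ _ _ _ ->] := exactU.
rewrite del_first_vandermonde del_last_vandermonde !mulmxA.
by rewrite -[_ *m T *m invmx T]mulmxA mulmxV ?exact_basis_unit // mulmx1.
Qed.

Let C_E := esprit_const (sigma q H)^-1 (sigma q (del_last U))^-1 (cond2 T).

Lemma esprit_const_exact_ge0 : 0 <= C_E.
Proof.
have s0 := exact_sigma_gt0; have t0 := exact_del_last_gt0.
have s1 := ltW s0; have t1 := ltW t0.
by rewrite /C_E /esprit_const !mulr_ge0 ?addr_ge0 ?invr_ge0 ?spectral_norm_ge0.
Qed.

(** [G] is the matrix of the projected basis [Ut *m Ut^t* *m U] in the basis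
    [Ut], so conjugating by it passes from [Ut] to a basis close to [U]; the
    further conjugation by [T] diagonalizes the exact shift operator. *)
Lemma esprit_mx_similar_diagonal (E : 'M[C]_(l.+1, K))
    (Ut : 'M[C]_(l.+1, q)) :
  spectral_norm E <= sigma q H * sigma q (del_last U) / 4 ->
  dominant_left_basis (H + E) Ut ->
  exists2 M : 'M[C]_q,
    char_poly (esprit_mx Ut) = char_poly (D + M) &
    forall x : 'cV_q, vnorm2 (M *m x) <= C_E * spectral_norm E * vnorm2 x.
Proof.
move=> Esmall domt.
have [_ _ z_inj domU UT] := exactU; have [UU _] := domU.
have s0 := exact_sigma_gt0; have t0 := exact_del_last_gt0.
have Tu := exact_basis_unit.
set s := sigma q H in s0 Esmall *; set t := sigma q (del_last U) in t0 Esmall *.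
have e0 := spectral_norm_ge0 E; set e := spectral_norm E in e0 Esmall *.
pose f := 2 * s^-1 * e.
have f0 : 0 <= f by rewrite !mulr_ge0 ?invr_ge0 // ltW.
have ft : f <= t / 2.
  rewrite /f mulrAC ler_pdivrMr //; lra.
pose F := Ut *m Ut^t* *m U - U.
have Ff (x : 'cV_q) : vnorm2 (F *m x) <= f * vnorm2 x.
  have -> : F *m x = - ((1%:M - Ut *m Ut^t*) *m (U *m x)).
    by rewrite /F mulmxBl mulmxBl mul1mx opprB !mulmxA.
  rewrite vnorm2N; apply: dominant_subspace_perturbation => //.
    by rewrite -addn1.
  exact: rank_exact_hankel.
have delD i (A B : 'M[C]_(l.+1, q)) : row' i (A + B) = row' i A + row' i B.
  by apply/matrixP => j k; rewrite !mxE.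
have GE i : (row' i Ut : 'M[C]_(l, q)) *m (Ut^t* *m U) = row' i U + row' i F.
  by rewrite -row'_mul -delD mulmxA /F addrC subrK.
have [||||Gu near_shift] :=
    shift_operator_perturbation t0 f0 ft exact_shift_invariance _ _ _ _
      (GE ord_max) (GE ord0).
- by move=> x; apply: smallest_singular_value.
- move=> x; rewrite /del_first -row'_mul (le_trans (vnorm2_row' _ _)) //.
  by rewrite vnorm2_isometry.
- by move=> x; rewrite -row'_mul (le_trans (vnorm2_row' _ _)).
- by move=> x; rewrite -row'_mul (le_trans (vnorm2_row' _ _)).
set S := invmx T *m D *m T in near_shift *.
set G := Ut^t* *m U in Gu near_shift *.
set St := mpinv _ *m _ in near_shift.
exists (T *m (invmx G *m St *m G - S) *m invmx T).
  have -> : D + T *m (invmx G *m St *m G - S) *m invmx T =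
      T *m invmx G *m St *m invmx (T *m invmx G).
    have -> : invmx (T *m invmx G) = G *m invmx T.
      apply: (can_inj (mulKmx (_ : T *m invmx G \in unitmx))).
        by rewrite unitmx_mul Tu unitmx_inv.
      rewrite mulmxV ?unitmx_mul ?unitmx_inv ?Tu //.
      by rewrite -mulmxA mulKmx // mulmxV.
    rewrite mulmxBr mulmxBl /S !mulmxA mulmxV // mul1mx mulmxK //.
    by rewrite addrC subrK.
  by rewrite char_poly_conj // unitmx_mul Tu unitmx_inv.
move: (invmx G *m St *m G - S) near_shift => W near_shift x; rewrite -!mulmxA.
apply: le_trans (le_spectral_norm _ _) _.
have b0 : 0 <= 2 * t^-1 * (1 + t^-1) * f.
  by rewrite mulr_ge0 // !mulr_ge0 ?addr_ge0 ?invr_ge0 // ltW.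
have bound := le_trans (near_shift _) (ler_wpM2l b0 (le_spectral_norm (invmx T) x)).
apply: le_trans (ler_wpM2l (spectral_norm_ge0 T) bound) _.
rewrite /f /e /s /t /C_E /esprit_const /cond2.
move: (spectral_norm T) (spectral_norm (invmx T)) (spectral_norm E) (vnorm2 x).
move: (sigma q H)^-1 (sigma q (del_last U))^-1 => a b u v w y.
by rewrite le_eqVlt; apply/orP; left; apply/eqP; ring.
Qed.

Lemma esprit_eigenvalue_perturbation :
  exists2 delta : R, 0 < delta &
    forall E : 'M[C]_(l.+1, K), spectral_norm E < delta ->
    forall Ut : 'M[C]_(l.+1, q), dominant_left_basis (H + E) Ut ->
    exists2 zetat : 'I_q -> C,
      eigenvalues_of (esprit_mx Ut) zetat &
      max_dist zetat zeta <= C_E * spectral_norm E.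
Proof.
have [_ _ z_inj _ _] := exactU.
have s0 := exact_sigma_gt0; have t0 := exact_del_last_gt0.
have CE0 := esprit_const_exact_ge0.
have CE1 : 0 < C_E + 1 by rewrite ltr_wpDl.
have [eta eta0 spectrum] := perturbed_diagonal_spectrum z_inj.
(* The summand 1 keeps the denominator positive. *)
exists (Num.min (sigma q H * sigma q (del_last U) / 4) (eta / (C_E + 1))).
  by rewrite lt_min !divr_gt0 ?mulr_gt0.
move=> E; rewrite lt_min => /andP [E1 E2] Ut domt.
have [M charM Mb] := esprit_mx_similar_diagonal (ltW E1) domt.
have [| |zt ztM ztz] := spectrum M (C_E * spectral_norm E) _ _ Mb.
- by rewrite mulr_ge0 ?spectral_norm_ge0.
- rewrite ltr_pdivlMr // mulrC in E2; apply: le_lt_trans E2.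
  by rewrite ler_wpM2r ?spectral_norm_ge0 // lerDl.
exists zt; last exact: ztz.
by rewrite /eigenvalues_of charM; exact: ztM.
Qed.

End Exact.
End Esprit.

Theorem theorem5p2 (R : realType) :
  exists CE : R -> R -> R -> R,
    (forall (q l K : nat) (m0 : int) (c zeta : 'I_q -> R[i])
            (U : 'M[R[i]]_(l.+1, q)) (T : 'M[R[i]]_q),
       (1 <= q)%N -> (q + 1 <= l.+1)%N -> (q <= K)%N ->
       exact_esprit m0 c zeta K U T ->
       let H := hankel m0 c zeta l.+1 K in
       let sigma_star := sigma q H in
       let s_star := sigma q (del_last U) in
       let C_E := CE sigma_star^-1 s_star^-1 (cond2 T) in
       [/\ 0 < sigma_star, 0 < s_star
         & exists2 delta : R, 0 < delta &
           forall E : 'M[R[i]]_(l.+1, K), spectral_norm E < delta ->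
           forall Ut : 'M[R[i]]_(l.+1, q), dominant_left_basis (H + E) Ut ->
           exists2 zetat : 'I_q -> R[i],
             eigenvalues_of (esprit_mx Ut) zetat &
             max_dist zetat zeta <= C_E * spectral_norm E])
    /\
    (forall (cut : set R[i]^o) (Log : R[i]^o -> R[i]^o) (N : set R[i]^o),
       log_branch cut Log ->
       compact N ->
       (exists r1 r2 : R, [/\ 0 < r1, r1 <= r2 & N `<=` annulus r1 r2]) ->
       N `&` cut = set0 ->
       exists C_log : R,
       forall (q l K : nat) (m0 : int) (c zeta : 'I_q -> R[i])
              (U : 'M[R[i]]_(l.+1, q)) (T : 'M[R[i]]_q),
         (1 <= q)%N -> (q + 1 <= l.+1)%N -> (q <= K)%N ->
         exact_esprit m0 c zeta K U T ->
         (forall j, N (zeta j)) ->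
         let H := hankel m0 c zeta l.+1 K in
         let sigma_star := sigma q H in
         let s_star := sigma q (del_last U) in
         let C_E := CE sigma_star^-1 s_star^-1 (cond2 T) in
         exists2 delta : R, 0 < delta &
           forall E : 'M[R[i]]_(l.+1, K), spectral_norm E < delta ->
           forall Ut : 'M[R[i]]_(l.+1, q), dominant_left_basis (H + E) Ut ->
           exists zetat : 'I_q -> R[i],
             [/\ eigenvalues_of (esprit_mx Ut) zetat,
                 max_dist zetat zeta <= C_E * spectral_norm E
               & max_dist (fun j => log_param Log (zetat j))
                          (fun j => log_param Log (zeta j))
                 <= C_log * C_E * spectral_norm E]).
Proof.
exists (@esprit_const R); split.
  move=> q l K m0 c zeta U T q0 ql qK exactU; split.
  - exact: exact_sigma_gt0 exactU.
  - exact: exact_del_last_gt0 exactU.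
  - exact: esprit_eigenvalue_perturbation exactU.
move=> cut Log N branch _ [r1 [r2 [r10 _ Nr]]] Ncut; exists (3 / r1).
move=> q l K m0 c zeta U T q0 ql qK exactU Nzeta H sigma_star s_star C_E.
have [delta delta0 eigs] := esprit_eigenvalue_perturbation q0 ql qK exactU.
have CE0 : 0 <= C_E := esprit_const_exact_ge0 q0 ql qK exactU.
have CE1 : 0 < C_E + 1 by rewrite ltr_wpDl.
have lip j : exists rho : R, 0 < rho /\ forall w, cabs (w - zeta j) < rho ->
    cabs (log_param Log w - log_param Log (zeta j)) <= 3 / r1 * cabs (w - zeta j).
  have zcut : ~ cut (zeta j).
    by move=> zj; have : (N `&` cut) (zeta j) by []; rewrite Ncut.
  have /andP [rz _] := Nr _ (Nzeta j).
  by have [rho rho0 ?] := log_locally_lipschitz branch zcut r10 rz; exists rho.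
have [rho rhoP] := choice lip.
have [rmin rmin0 rho_ge] := finite_pos_lower_bound (A := predT)
  (fun j _ => (rhoP j).1).
exists (Num.min delta (rmin / (C_E + 1))).
  by rewrite lt_min delta0 divr_gt0.
move=> E; rewrite lt_min ltr_pdivlMr // => /andP [E1 E2] Ut domt.
have [zt ztE ztz] := eigs E E1 Ut domt; exists zt; split => //.
have small : C_E * spectral_norm E < rmin.
  apply: le_lt_trans E2; rewrite mulrC.
  by rewrite ler_wpM2l ?spectral_norm_ge0 // lerDl.
apply: bigmax_le => [|j _].
  by rewrite mulr_ge0 ?spectral_norm_ge0 // mulr_ge0 // divr_ge0 // ltW.
have zj : cabs (zt j - zeta j) <= C_E * spectral_norm E.
  exact: le_trans (le_max_dist _ _ _) ztz.
apply: le_trans ((rhoP j).2 _ _) _.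
  by rewrite (le_lt_trans zj) // (lt_le_trans small) // rho_ge.
by rewrite -[leRHS]mulrA ler_wpM2l // divr_ge0 // ltW.
Qed.
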